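(* Let $\varepsilon>0$, $\tau\ge0$ and $\lambda:=\tau/\varepsilon\in[0,1]$, and let $u_n\in\mathcal V_{[0,1]}$. Then $u_{n+1}$ satisfies the SDIE update $$(1-\lambda)u_{n+1}-\mathcal S_\tau u_n+\frac\lambda2\mathbf 1=\lambda\beta_{n+1}$$ for some $\beta_{n+1}\in\mathcal B(u_{n+1})$ if and only if $u_{n+1}$ solves $$u_{n+1}\in\operatorname*{argmin}_{u\in\mathcal V_{[0,1]}}\ \lambda\langle u,\mathbf 1-u\rangle_{\mathcal V}+\|u-\mathcal S_\tau u_n\|_{\mathcal V}^2 .\qquad(\ast)$$ For $\lambda=1$, problem $(\ast)$ is equivalent to the variational problem defining the MBO scheme with fidelity forcing, namely $u_{n+1}\in\operatorname*{argmin}_{u\in\mathcal V_{[0,1]}}\langle\mathbf 1-2\mathcal S_\tau u_n,u\rangle_{\mathcal V}$. Furthermore, for $\lambda\in[0,1)$ problem $(\ast)$ has the unique solution given by $$(u_{n+1})_i=\begin{cases}0,&\text{if }(\mathcal S_\tau u_n)_i<\frac12\lambda,\\[2pt] \frac12+\frac{(\mathcal S_\tau u_n)_i-1/2}{1-\lambda},&\text{if }\frac12\lambda\le(\mathcal S_\tau u_n)_i<1-\frac12\lambda,\\[2pt] 1,&\text{if }(\mathcal S_\tau u_n)_i\ge1-\frac12\lambda,\end{cases}$$ with (when $\lambda\in(0,1)$) corresponding $\beta_{n+1}=\lambda^{-1}\left((1-\lambda)u_{n+1}-\mathcal S_\tau u_n+\frac\lambda2\mathbf 1\right)$; and for $\lambda=1$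 the solutions of $(\ast)$ are exactly the $u_{n+1}$ with $$(u_{n+1})_i\in\begin{cases}\{1\},&(\mathcal S_\tau u_n)_i>1/2,\\ [0,1],&(\mathcal S_\tau u_n)_i=1/2,\\ \{0\},&(\mathcal S_\tau u_n)_i<1/2,\end{cases}$$ with corresponding $\beta_{n+1}=\frac12\mathbf 1-\mathcal S_\tau u_n$.
   Context: Graph setting. $G=(V,E)$ is a finite, simple, undirected, weighted, connected graph without self-loops, with weights $\omega_{ij}\ge0$, $\omega_{ij}=\omega_{ji}$, $\omega_{ii}=0$, and $\omega_{ij}>0$ iff $ij\in E$; it has at least two vertices, so all degrees $d_i:=\sum_{j\in V}\omega_{ij}$ are positive. Fix $r\in[0,1]$. $\mathcal V:=\{u:V\to\mathbb R\}$; for $X\subseteq\mathbb R$, $\mathcal V_X:=\{u:V\to X\}$. Inner product $\langle u,v\rangle_{\mathcal V}:=\sum_{i\in V}u_iv_id_i^r$ with norm $\|\cdot\|_{\mathcal V}$. Graph Laplacian: $(\Delta u)_i:=d_i^{-r}\sum_{j\in V}\omega_{ij}(u_i-u_j)$. $\mathbf 1$ and $\mathbf 0$ are the constant functions $1$ and $0$ on $V$, $I$ is the identity. Fidelity. Fixed throughout: $\mu\in\mathcal V_{[0,\infty)}\setminus\{\mathbf 0\}$ and $\tilde f\in\mathcal V_{[0,1]}$. $M:=\operatorname{diag}(\mu)$, $A:=\Delta+M$ (which is invertible), $f:=M\tilde f$. Fidelity forced diffusion: $\mathcal S_tu:=e^{-tA}u+A^{-1}(I-e^{-tA})f$ for $t\ge0$,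 $u\in\mathcal V$. Subdifferential set. For $u\in\mathcal V$, $\mathcal B(u)=\emptyset$ if $u\notin\mathcal V_{[0,1]}$; for $u\in\mathcal V_{[0,1]}$, $\mathcal B(u)$ is the set of $\beta\in\mathcal V$ such that for each $i\in V$: $\beta_i\in[0,\infty)$ if $u_i=0$, $\beta_i=0$ if $0<u_i<1$, and $\beta_i\in(-\infty,0]$ if $u_i=1$. Equivalence of minimisation problems: problems with objectives $F$ and $G$ (over the same set) are equivalent when $G(u)=aF(u)+b$ with $a>0$ and $b$ independent of $u$. *)

(* Defs.v *)
From HB Require Import structures.
From mathcomp Require Import all_boot all_order all_algebra.
From mathcomp Require Import all_classical all_reals all_analysis.
From mathcomp Require Import ring lra.

Set Implicit Arguments.
Unset Strict Implicit.
Unset Printing Implicit Defensive.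

Import Order.TTheory GRing.Theory Num.Theory.
Import numFieldNormedType.Exports.

Local Open Scope classical_set_scope.
Local Open Scope ring_scope.

(* The edge set is determined by the weights: ij is an edge iff 0 < w i j. *)
Record weighted_graph (R : realType) (V : finType) := WeightedGraph {
  weight :> V -> V -> R;
  weight_ge0 : forall i j, 0 <= weight i j;
  weight_sym : forall i j, weight i j = weight j i;
  weight_diag : forall i, weight i i = 0;
  weight_connected : forall i j, connect (fun k l => 0 < weight k l) i j;
  weight_order : (1 < #|V|)%N
}.

(* R^o is R seen as a one-dimensional vector space over itself; it makes
   the node functions a finite-dimensional vectType over R. *)
Notation vfun R V := {ffun V -> R^o}.

Section NodeFunctions.
Variables (R : realType) (V : finType).
Implicit Types (u v b f : vfun R V) (X : set R).

Definition vset X : set (vfun R V) := [set u | forall i, X (u i)].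

Definition V01 : set (vfun R V) := vset `[0, 1]%classic.

Definition vconst (c : R) : vfun R V := [ffun=> c].

Definition vmul (mu u : vfun R V) : vfun R V := [ffun i => (mu i : R) * u i : R].

Definition subdiff u : set (vfun R V) :=
  [set b | V01 u /\
    forall i, [/\ u i = 0 :> R -> 0 <= (b i : R),
                  0 < (u i : R) < 1 -> b i = 0 :> R
                & u i = 1 :> R -> (b i : R) <= 0]].

(* e^B u, with e^B = sum_k B^k / k!; the limit is taken entry by entry. *)
Definition expop (B : vfun R V -> vfun R V) u : vfun R V :=
  [ffun i => limn (series (fun k => (k`!%:R)^-1 * (iter k B u i : R))) : R].

Definition argmin (X : set (vfun R V)) (F : vfun R V -> R) : set (vfun R V) :=
  [set u | X u /\ forall v, X v -> F u <= F v].

Definition equiv_min (X : set (vfun R V)) (F G : vfun R V -> R) : Prop :=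
  exists a b : R, 0 < a /\ forall u, X u -> G u = a * F u + b.

End NodeFunctions.

Arguments V01 {R V}.
Arguments vconst {R V}.

Section Graph.
Variables (R : realType) (V : finType) (w : weighted_graph R V) (r : R).
Implicit Types (u v mu f : vfun R V).

Definition degree (i : V) : R := \sum_j w i j.

Definition inner u v : R := \sum_i (u i : R) * v i * degree i `^ r.

Definition vnorm u : R := Num.sqrt (inner u u).

Definition laplacian u : vfun R V :=
  [ffun i => degree i `^ (- r) * (\sum_j w i j * ((u i : R) - u j)) : R].

Section Fidelity.
Variables (mu ftilde : vfun R V).

Definition fid_op u : vfun R V := laplacian u + vmul mu u.

Fact fid_op_is_linear : linear fid_op.
Proof.
move=> a u v; apply/ffunP => i.
have sumE : \sum_j w i j * (((a *: u + v) i : R) - (a *: u + v) j) =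
    a * (\sum_j w i j * ((u i : R) - u j)) + \sum_j w i j * ((v i : R) - v j).
  rewrite mulr_sumr -big_split /=; apply: eq_bigr => j _.
  by rewrite !ffunE /GRing.scale /=; ring.
rewrite [LHS]ffunE [X in X + _]ffunE sumE !ffunE /GRing.scale /=.
ring.
Qed.

(* fid_op is bijective for mu >= 0, mu != 0 (by connectedness), so fid_lin^-1,
   for a general map only a right inverse on its range, is the true inverse. *)
HB.instance Definition _ :=
  GRing.isLinear.Build R (vfun R V) (vfun R V) *:%R fid_op fid_op_is_linear.

Definition fid_lin : 'End(vfun R V) := linfun fid_op.

Definition fid_flow (t : R) u : vfun R V :=
  let E := expop (fun v => - t *: fid_op v) in
  let f := vmul mu ftilde in
  E u + (fid_lin^-1)%VF (f - E f).

End Fidelity.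

Definition sdie_objective (lam : R) (s u : vfun R V) : R :=
  lam * inner u (vconst 1 - u) + vnorm (u - s) ^+ 2.

Definition mbo_objective (s u : vfun R V) : R :=
  inner (vconst 1 - 2 *: s) u.

End Graph.

Definition sdie (R : realType) (V : finType) (lam : R) (s u b : vfun R V) : Prop :=
  (1 - lam) *: u - s + (lam / 2) *: vconst 1 = lam *: b.

(* Main.v *)
(* The objective is separable: up to the positive weights d_i^r, it minimises
   at each node the quadratic [lam * x * (1 - x) + (x - s_i) ^+ 2] over [0, 1].
   For lam <= 1 it is convex, with derivative twice
   [(1 - lam) * x - s_i + lam / 2], so the minimisers are given by the
   first-order sign conditions at the endpoints, which are the SDIE with
   beta in the subdifferential.  When lam = 0 the SDIE forces u = s, so that
   s must lie in [0, 1]; this holds because then tau = 0 and s = u_n. *)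

Require Import Defs.
From HB Require Import structures.
From mathcomp Require Import all_boot all_order all_algebra.
From mathcomp Require Import all_classical all_reals all_analysis.
From mathcomp Require Import ring lra.

Set Implicit Arguments.
Unset Strict Implicit.
Unset Printing Implicit Defensive.

Import Order.TTheory GRing.Theory Num.Theory.
Import numFieldNormedType.Exports.

Local Open Scope classical_set_scope.
Local Open Scope ring_scope.

(** * The quadratic problem at a single node *)

Section NodeProblem.
Variable R : realType.
Implicit Types lam s x y : R.

Definition node_objective lam s x : R := lam * (x * (1 - x)) + (x - s) ^+ 2.

Definition node_slope lam s x : R := (1 - lam) * x - s + lam / 2.

(** Exact Taylor expansion at [x]: the derivative is [2 * node_slope lam s x], and the second-order
    coefficient [1 - lam] is nonnegative exactly when the quadratic is convex. *)
Lemma node_objectiveB lam s x y :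
  node_objective lam s y - node_objective lam s x =
  (y - x) * (2 * node_slope lam s x + (1 - lam) * (y - x)).
Proof. by rewrite /node_objective /node_slope; field. Qed.

(** This symmetry exchanges the endpoints 0 and 1, so only one of the two endpoint conditions has to
    be proved directly. *)
Lemma node_objective_flip lam s x :
  node_objective lam (1 - s) (1 - x) = node_objective lam s x.
Proof. by rewrite /node_objective; ring. Qed.

Lemma node_slope_flip lam s x :
  node_slope lam (1 - s) (1 - x) = - node_slope lam s x.
Proof. by rewrite /node_slope; field. Qed.

Lemma node_min_slope_ge0 lam s x : 0 <= lam -> 0 <= x < 1 ->
  (forall y, 0 <= y <= 1 -> node_objective lam s x <= node_objective lam s y) ->
  0 <= node_slope lam s x.
Proof.
move=> lam0 /andP[x0 x1] xmin; rewrite leNgt; apply/negP => D0.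
(* The first bound keeps [x + t] in [0, 1]; the second makes the bracket of the expansion at most
   [node_slope lam s x], hence negative. *)
pose t := Num.min (1 - x) (- node_slope lam s x).
have t0 : 0 < t by rewrite lt_min subr_gt0 x1 oppr_gt0.
have [tx tD] : t <= 1 - x /\ t <= - node_slope lam s x.
  by split; rewrite ge_min lexx ?orbT.
have /xmin : 0 <= x + t <= 1 by apply/andP; split; lra.
rewrite -subr_ge0 node_objectiveB addrAC subrr add0r pmulr_rge0 //.
have : 0 <= lam * t by rewrite mulr_ge0 // ltW.
by lra.
Qed.

(** Necessity is the previous lemma and its mirror image. For sufficiency, the slope has the sign of
    [y - x] or vanishes, and the quadratic term is nonnegative by convexity. *)
Lemma node_minP lam s x : 0 <= lam <= 1 -> 0 <= x <= 1 ->
  (forall y, 0 <= y <= 1 -> node_objective lam s x <= node_objective lam s y) <->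
  (x < 1 -> 0 <= node_slope lam s x) /\ (0 < x -> node_slope lam s x <= 0).
Proof.
move=> /andP[lam0 lam1] /andP[x0 x1]; split=> [xmin|[Dge0 Dle0] y /andP[y0 y1]].
  split=> [xlt1|xgt0]; first by apply: node_min_slope_ge0; rewrite ?x0.
  rewrite -oppr_ge0 -node_slope_flip; apply: node_min_slope_ge0 => //.
    by apply/andP; split; lra.
  move=> y /andP[y0 y1]; rewrite node_objective_flip.
  have -> : y = 1 - (1 - y) by ring.
  by rewrite node_objective_flip; apply: xmin; apply/andP; split; lra.
rewrite -subr_ge0 node_objectiveB mulrDr addr_ge0 //; last first.
  by rewrite mulrCA mulr_ge0 ?subr_ge0// -expr2 sqr_ge0.
have [xy|yx|->] := ltgtP x y; last by rewrite subrr mul0r.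
  have D0 := Dge0 (lt_le_trans xy y1).
  by rewrite !mulr_ge0 // subr_ge0 ltW.
have D0 := Dle0 (le_lt_trans y0 yx).
by rewrite mulr_le0 ?subr_le0 ?(ltW yx) // mulr_ge0_le0.
Qed.

End NodeProblem.

(** * Reduction from node functions to single nodes *)

Section Separable.
Variables (R : realType) (V : finType).
Implicit Types u v b : vfun R V.

Lemma V01P u : V01 u <-> forall i, 0 <= (u i : R) <= 1.
Proof. by split=> uP i; have := uP i; rewrite /= in_itv. Qed.

Lemma argmin_separable (c : V -> R) (g : V -> R -> R) (F : vfun R V -> R) u :
  (forall i, 0 < c i) -> (forall v, F v = \sum_i g i (v i) * c i) ->
  argmin V01 F u <-> forall i, 0 <= (u i : R) <= 1 /\
    forall y : R, 0 <= y <= 1 -> g i (u i) <= g i y.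
Proof.
move=> c0 FE; split=> [[/V01P u01 umin] i|umin].
  split=> // y y01.
  (* Changing [u] at one node leaves all other summands equal, so they cancel. *)
  pose v : vfun R V := [ffun j => if j == i then y else u j].
  have /umin : V01 v by apply/V01P => j; rewrite ffunE; case: eqP.
  rewrite !FE (bigD1 i) //= [X in _ <= X](bigD1 i) //=.
  rewrite (eq_bigr (fun j => g j (v j) * c j)); last first.
    by move=> j /negPf ji; rewrite ffunE ji.
  by rewrite lerD2r ffunE eqxx ler_pM2r.
split=> [|v /V01P v01]; first by apply/V01P => i; have [] := umin i.
rewrite !FE; apply: ler_sum => i _; rewrite ler_pM2r //.
by have [_] := umin i; apply.
Qed.

Lemma expop_zero (B : vfun R V -> vfun R V) u :
  (forall v, B v = 0) -> expop B u = u.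
Proof.
move=> B0; apply/ffunP => i; rewrite ffunE.
(* The partial sum of length 0 is 0; all later ones equal the term [k = 0], so the sequence is
   constant only after a shift by one. *)
apply/cvg_lim => //; rewrite -(cvg_shiftS _).
rewrite (_ : (fun n => _) = (fun=> u i : R)); first exact: cvg_cst.
apply/funext => n; rewrite /series /= big_nat_recl //= big1 ?addr0.
  by rewrite fact0 invr1 mul1r.
by move=> k _; rewrite B0 ffunE mulr0.
Qed.

Lemma sdieP (lam : R) (s u b : vfun R V) :
  sdie lam s u b <-> forall i, node_slope lam (s i) (u i) = lam * (b i : R).
Proof.
rewrite /sdie; split=> [/ffunP sb i|sb].
  by have := sb i; rewrite !ffunE /GRing.scale /= mulr1.
by apply/ffunP => i; rewrite !ffunE /GRing.scale /= mulr1 -sb.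
Qed.

Lemma sdie_residual (lam : R) (s u b : vfun R V) : lam != 0 ->
  sdie lam s u b <->
  b = lam^-1 *: ((1 - lam) *: u - s + (lam / 2) *: vconst 1).
Proof.
move=> lam0; rewrite /sdie; split=> [->|->].
  by rewrite scalerA mulVf // scale1r.
by rewrite scalerA divff // scale1r.
Qed.

End Separable.

(** * The graph objective and the flow at time zero *)

Section Graph.
Variables (R : realType) (V : finType) (w : weighted_graph R V) (r : R).
Implicit Types (lam : R) (u s b : vfun R V).

(** A second vertex exists, and the first edge of a path from [i] to it has positive weight. *)
Lemma degree_gt0 i : 0 < degree w i.
Proof.
have [j ji] : exists j, j != i.
  by apply/existsP; rewrite -negb_forall; apply/negP => /forallP Vi;
    have := weight_order w; rewrite ltnNge => /negP; apply;
    apply/fintype_le1P => x y; rewrite (eqP (Vi x)) (eqP (Vi y)).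
have /connectP[[|k p] /=] := weight_connected w i j.
  by move=> _ jE; rewrite jE eqxx in ji.
move=> /andP[wik _] _; rewrite /degree (bigD1 k) //= ltr_pwDl //.
by apply: sumr_ge0 => l _; exact: weight_ge0.
Qed.

Lemma sdie_objectiveE lam s u : sdie_objective w r lam s u =
  \sum_i node_objective lam (s i) (u i) * degree w i `^ r.
Proof.
rewrite /sdie_objective /vnorm sqr_sqrtr; last first.
  by apply: sumr_ge0 => i _; rewrite mulr_ge0 ?powR_ge0 // -expr2 sqr_ge0.
rewrite /inner mulr_sumr -big_split /=; apply: eq_bigr => i _.
by rewrite !ffunE /node_objective; ring.
Qed.

Lemma sdie_argminP lam s u : 0 <= lam <= 1 ->
  argmin V01 (sdie_objective w r lam s) u <-> forall i, [/\ 0 <= (u i : R) <= 1,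
    (u i : R) < 1 -> 0 <= node_slope lam (s i) (u i) &
    0 < (u i : R) -> node_slope lam (s i) (u i) <= 0].
Proof.
move=> lam01.
have c0 i : 0 < degree w i `^ r by rewrite powR_gt0 // degree_gt0.
rewrite (@argmin_separable _ _ _ (fun i => node_objective lam (s i)) _ u c0);
  last exact: sdie_objectiveE.
split=> umin i.
  by have [u01 /(node_minP _ lam01 u01)[D0 D1]] := umin i; split.
by have [u01 *] := umin i; split=> //; apply/(node_minP _ lam01 u01).
Qed.

(** Both exponentials are the identity at time 0, so the forcing term is the image of 0 under a
    linear map. *)
Lemma fid_flow0 (mu ftilde : vfun R V) u : fid_flow w r mu ftilde 0 u = u.
Proof.
have E0 v : expop (fun v' => - 0 *: fid_op w r mu v') v = v.
  by apply: expop_zero => v'; rewrite oppr0 scale0r.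
by rewrite /fid_flow !E0 subrr linear0 addr0.
Qed.

(** * SDIE updates as minimisers *)

Lemma sdie_subdiff_argmin lam s u b : 0 <= lam <= 1 ->
  subdiff u b -> sdie lam s u b -> argmin V01 (sdie_objective w r lam s) u.
Proof.
move=> lam01 [/V01P u01 bu] /sdieP sb; apply/sdie_argminP => // i.
have /andP[lam0 _] := lam01; have /andP[u0 u1] := u01 i.
have [b0 b01 b1] := bu i; rewrite u0 u1 sb; split=> // ui.
  apply: mulr_ge0 => //; move: u0; rewrite le_eqVlt => /orP[/eqP/esym/b0//|u0].
  by rewrite b01 ?u0.
apply: mulr_ge0_le0 => //; move: u1; rewrite le_eqVlt => /orP[/eqP/b1//|u1].
by rewrite b01 ?ui.
Qed.

(** For [0 < lam] the slope [lam * b i] has the sign of [b i], so the first-order conditions become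
    sign conditions on [b]; at interior values both apply and force [b i = 0]. *)
Lemma argmin_subdiff lam s u b : 0 < lam <= 1 ->
  argmin V01 (sdie_objective w r lam s) u -> sdie lam s u b -> subdiff u b.
Proof.
move=> /andP[lam0 lam1] /sdie_argminP; rewrite ltW // => /(_ lam1) umin.
move=> /sdieP sb; split; first by apply/V01P => i; have [] := umin i.
move=> i; have [_ +] := umin i.
rewrite sb pmulr_rge0 // pmulr_rle0 // => b0 b1.
split=> [ui|/andP[u0 u1]|ui]; [by apply: b0; rewrite ui| |by apply: b1; rewrite ui].
by apply/eqP; rewrite eq_le b0 ?b1.
Qed.

Lemma sdie_argmin lam s u : 0 <= lam <= 1 -> (lam = 0 -> V01 s) ->
  (exists b, subdiff u b /\ sdie lam s u b) <->
  argmin V01 (sdie_objective w r lam s) u.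
Proof.
move=> lam01 s01; split=> [[b [ub sb]]|umin].
  exact: sdie_subdiff_argmin ub sb.
have /andP[lam0 lam1] := lam01.
move: lam0; rewrite le_eqVlt => /orP[/eqP lam0|lam0].
  (* At [lam = 0] the slope is [u i - s i]. The SDIE reads [u = s], and 0 lies in the
     subdifferential of any [u] in [V01]. *)
  move: umin => /sdie_argminP => /(_ lam01) umin; exists 0; split.
    by split=> [|i]; [apply/V01P => i; have [] := umin i|rewrite ffunE].
  have /V01P {}s01 := s01 (esym lam0).
  apply/sdieP => i; have := umin i; have := s01 i.
  rewrite /node_slope -lam0 ffunE => /andP[? ?] [/andP[? ?] D0 D1].
  (* Inside (0, 1) the slope vanishes; at an endpoint its sign and [0 <= s i <= 1] leave only
     [s i = u i]. *)
  case: (ltP (u i : R) 1) => u1; case: (ltP 0 (u i : R)) => u0;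
    try (have := D0 u1); try (have := D1 u0); lra.
exists (lam^-1 *: ((1 - lam) *: u - s + (lam / 2) *: vconst 1)).
have sb := (sdie_residual s u _ (lt0r_neq0 lam0)).2 erefl.
by split=> //; apply: argmin_subdiff umin sb; rewrite lam0.
Qed.

Lemma sdie_residual_argmin lam s u b : 0 < lam <= 1 ->
  argmin V01 (sdie_objective w r lam s) u ->
  (subdiff u b /\ sdie lam s u b) <->
  b = lam^-1 *: ((1 - lam) *: u - s + (lam / 2) *: vconst 1).
Proof.
move=> lam01 umin; have /andP[lam0 _] := lam01.
rewrite -sdie_residual ?gt_eqF //; split=> [[]//|sb]; split=> //.
exact: argmin_subdiff umin sb.
Qed.

(** * The MBO case and explicit solutions *)

Lemma equiv_min_mbo s :
  equiv_min V01 (sdie_objective w r 1 s) (mbo_objective w r s).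
Proof.
(* At [lam = 1] the squares of [u i] cancel: [x * (1 - x) + (x - s) ^+ 2 = (1 - 2 * s) * x + s ^+
   2]. *)
exists 1, (- \sum_i (s i : R) ^+ 2 * degree w i `^ r); split=> // u _.
rewrite mul1r sdie_objectiveE /mbo_objective /inner -sumrB.
by apply: eq_bigr => i _; rewrite !ffunE /GRing.scale /= /node_objective; ring.
Qed.

(** For [lam < 1] the slope is strictly increasing in [x], and the minimiser is its zero truncated
    to [0, 1]. The middle formula is that zero; it reaches 0 at [s i = lam / 2] and 1 at
    [s i = 1 - lam / 2]. *)
Lemma argmin_lt1 lam s : 0 <= lam -> lam < 1 ->
  argmin V01 (sdie_objective w r lam s) =
  [set [ffun i => (if (s i : R) < lam / 2 then 0
                   else if (s i : R) < 1 - lam / 2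
                        then 1 / 2 + ((s i : R) - 1 / 2) / (1 - lam)
                   else 1) : R]].
Proof.
move=> lam0 lam1.
have l0 : 0 < 1 - lam by lra.
have midE (t : R) : node_slope lam t (1 / 2 + (t - 1 / 2) / (1 - lam)) = 0.
  by rewrite /node_slope; field; rewrite gt_eqF.
apply/seteqP; split=> u.
  move=> /sdie_argminP; rewrite lam0 ltW // => /(_ isT) umin.
  apply/ffunP => i; rewrite ffunE.
  have [/andP[u0 u1] D0 D1] := umin i.
  (* Linear arithmetic cannot derive the signs of these products, so they are supplied. *)
  have le0 : 0 <= (1 - lam) * (u i : R) by rewrite mulr_ge0 ?(ltW l0).
  have le1 : 0 <= (1 - lam) * (1 - (u i : R)) by rewrite mulr_ge0 ?(ltW l0) ?subr_ge0.
  move: D0 D1 (midE (s i)); set x := _ + _ / (1 - lam).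
  rewrite /node_slope => D0 D1 xE.
  case: ltP => s0; last case: ltP => s1.
  - apply/eqP; rewrite eq_le u0 andbT leNgt; apply/negP => ugt0.
    by have := D1 ugt0; lra.
  - have: (1 - lam) * (u i : R) = (1 - lam) * x; last first.
      by apply: mulfI; rewrite gt_eqF.
    (* An interior minimiser has slope zero. The value 0 forces [s i = lam / 2], where the formula
       also gives 0; the value 1 contradicts [s i < 1 - lam / 2]. *)
    case: (ltP (u i : R) 1) => ui1; case: (ltP 0 (u i : R)) => ui0;
      try (have := D0 ui1); try (have := D1 ui0); try lra.
    + have -> : u i = 0 :> R by apply/eqP; rewrite eq_le u0 ui0.
      lra.
    + have -> : u i = 1 :> R by apply/eqP; rewrite eq_le u1 ui1.
      lra.
  - apply/eqP; rewrite eq_le u1 leNgt; apply/negP => ult1.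
    have : 0 < (1 - lam) * (1 - (u i : R)) by rewrite mulr_gt0 // subr_gt0.
    by have := D0 ult1; lra.
move=> -> /=; apply/sdie_argminP; first by rewrite lam0 ltW.
move=> i; rewrite ffunE; case: ltP => s0 /=; last case: ltP => s1 /=.
- by rewrite /node_slope; split; rewrite ?lexx ?ltxx ?ler01 //; lra.
- rewrite midE; split=> //; set x := _ + _ / (1 - lam).
  have xE : (1 - lam) * x = s i - lam / 2.
    by have := midE (s i); rewrite -/x /node_slope; lra.
  have x0 : 0 <= x by rewrite -(pmulr_rge0 _ l0) xE; lra.
  have x1 : x <= 1 by rewrite -(ler_pM2l l0) xE; lra.
  by rewrite x0.
- by rewrite /node_slope; split; rewrite ?lexx ?ltxx ?ler01 //; lra.
Qed.

(** At [lam = 1] the slope is [1 / 2 - s i] whatever the value of [u i], so its sign selects an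
    endpoint, or leaves [u i] free in [0, 1] when it vanishes. *)
Lemma argmin_eq1 s :
  argmin V01 (sdie_objective w r 1 s) =
  [set u : vfun R V | forall i,
    [/\ 1 / 2 < (s i : R) -> u i = 1 :> R,
        s i = 1 / 2 :> R -> 0 <= (u i : R) <= 1
      & (s i : R) < 1 / 2 -> u i = 0 :> R]].
Proof.
apply/seteqP; split=> u /=.
  move=> /sdie_argminP; rewrite ler01 lexx => /(_ isT) umin i.
  have [u01 D0 D1] := umin i; have /andP[u0 u1] := u01.
  move: D0 D1; rewrite /node_slope => D0 D1.
  split=> // si; apply/eqP; rewrite eq_le ?u0 ?u1 ?andbT /=;
    rewrite leNgt; apply/negP => ui.
    by have := D0 ui; lra.
  by have := D1 ui; lra.
move=> uP; apply/sdie_argminP; first by rewrite ler01 lexx.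
move=> i; have [s1 se s0] := uP i; rewrite /node_slope.
have [si|si|si] := ltgtP (s i : R) (1 / 2).
- by rewrite s0 //; split; rewrite ?lexx ?ltxx ?ler01 //; lra.
- by rewrite s1 //; split; rewrite ?lexx ?ltxx ?ler01 //; lra.
- by rewrite si; split; [exact: se|lra|lra].
Qed.

End Graph.

Theorem theorem2p9 (R : realType) (V : finType) (w : weighted_graph R V)
    (r : R) (hr : 0 <= r <= 1)
    (mu ftilde : vfun R V)
    (hmu : vset `[0, +oo[%classic mu) (hmu0 : mu <> vconst 0)
    (hf : V01 ftilde)
    (eps tau lam : R) (heps : 0 < eps) (htau : 0 <= tau)
    (hlam : lam = tau / eps) (hlam01 : 0 <= lam <= 1)
    (un : vfun R V) (hun : V01 un) :
  let s := fid_flow w r mu ftilde tau un in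
  let sol := argmin V01 (sdie_objective w r lam s) in
  [/\ forall u : vfun R V,
        (exists b, subdiff u b /\ sdie lam s u b) <-> sol u,
      lam = 1 ->
        equiv_min V01 (sdie_objective w r lam s) (mbo_objective w r s),
      lam < 1 ->
        let u : vfun R V :=
          [ffun i => (if (s i : R) < lam / 2 then 0
                      else if (s i : R) < 1 - lam / 2
                           then 1 / 2 + ((s i : R) - 1 / 2) / (1 - lam)
                      else 1) : R] in
        sol = [set u] /\
        (0 < lam -> forall b : vfun R V,
           (subdiff u b /\ sdie lam s u b) <->
           b = lam^-1 *: ((1 - lam) *: u - s + (lam / 2) *: vconst 1))
    & lam = 1 ->
        sol = [set u : vfun R V | forall i,
                 [/\ 1 / 2 < (s i : R) -> u i = 1 :> R,
                     s i = 1 / 2 :> R -> 0 <= (u i : R) <= 1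
                   & (s i : R) < 1 / 2 -> u i = 0 :> R]] /\
        (forall u : vfun R V, sol u -> forall b : vfun R V,
           (subdiff u b /\ sdie lam s u b) <->
           b = (1 / 2) *: vconst 1 - s)].
Proof.
move=> s sol; have /andP[lam0 lam1] := hlam01; split.
- move=> u; apply: sdie_argmin => // lamE.
  (* Since [tau = lam * eps], the case [lam = 0] gives [s = un], which lies in [V01]. *)
  have tau0 : tau = 0 by rewrite -(divfK (lt0r_neq0 heps) tau) -hlam lamE mul0r.
  by rewrite /s tau0 fid_flow0.
- by move=> lamE; rewrite lamE; exact: equiv_min_mbo.
- move=> lamlt1 u; have solE : sol = [set u] by exact: argmin_lt1.
  split=> // lamgt0 b; apply: (@sdie_residual_argmin _ _ w r).
    by rewrite lamgt0.
  by rewrite -/sol solE.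
- move=> lamE; split; first by rewrite /sol lamE; exact: argmin_eq1.
  move=> u solu b.
  rewrite (@sdie_residual_argmin _ _ w r) //; last by rewrite lamE ltr01 lexx.
  (* At [lam = 1] the coefficient of [u] in the residual vanishes. *)
  by rewrite lamE invr1 scale1r subrr scale0r add0r addrC.
Qed.
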